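(* Let $\mathcal D=(D,\min,+_D,\infty_D,0_D)$ be a commutative, totally ordered, idempotent dioid, $\mathcal A=(A,+_A,\times_A,0_A,1_A)$ a commutative semiring, $S,T$ finite sets, $w$ a $\mathcal D$-measure over $(S,T)$ and $\mu$ an $\mathcal A$-measure over $(S,T)$. Then the function $w\Delta\mu$ which maps every $\mathcal F\subseteq T^{S'}$, for every $S'\subseteq S$, to $$(w\Delta\mu)(\mathcal F)=w(\mathcal F)\,\Delta\,\mu(\operatorname{argmin}_w(\mathcal F)),$$ i.e. to $(w(\mathcal F),\mu(\operatorname{argmin}_w(\mathcal F)))$ if $w(\mathcal F)\in reg(\mathcal D)$ and to $(w(\mathcal F),0_A)$ otherwise, where $\operatorname{argmin}_w(\mathcal F)=\{f\in\mathcal F: w(\{f\})=w(\mathcal F)\}$, is a $(\mathcal D\Delta\mathcal A)$-measure over $(S,T)$.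
   Context: For $f_1\in T^{S_1}$, $f_2\in T^{S_2}$ with $S_1\cap S_2=\emptyset$, $f_1\Join f_2\in T^{S_1\cup S_2}$ agrees with $f_1$ on $S_1$ and $f_2$ on $S_2$; $T^\emptyset$ is the one-element set containing the empty function. For a commutative semiring $\mathcal B=(B,+,\times,0,1)$, a $\mathcal B$-measure over $(S,T)$ is a function $\mu$ assigning to every $S'\subseteq S$ and every $\mathcal F\subseteq T^{S'}$ a value $\mu(\mathcal F)\in B$ such that $\mu(\emptyset)=0$, $\mu(T^\emptyset)=1$, $\mu(\mathcal F_1\cup\mathcal F_2)=\mu(\mathcal F_1)+\mu(\mathcal F_2)$ for disjoint $\mathcal F_1,\mathcal F_2\subseteq T^{S'}$, and $\mu(\{f_1\Join f_2\})=\mu(\{f_1\})\times\mu(\{f_2\})$ for $f_1\in T^{S_1}$, $f_2\in T^{S_2}$ with $S_1,S_2\subseteq S$ disjoint. A dioid is a semiring $(D,\min,+_D,\infty_D,0_D)$ ($\min$ names the additive operation, $+_D$ the multiplicative one) for which $d_1\le_D d_2\iff\exists c,\ \min(d_2,c)=d_1$ is a partial order; idempotent if $\min(d,d)=d$; totally ordered if $\le_D$ total. $d\in D\setminus\{\infty_D\}$ is multiplicatively regular if $d+_Db=d+_Dc\Rightarrow b=c$; $reg(\mathcal D)$ is the set of these. $d\Delta a=(d,a)$ if $d\in reg(\mathcal D)$, else $(d,0_A)$. The delta product is the semiring $\mathcal D\Delta\mathcal A=(D\Delta A,\oplus,\otimes,(\infty_D,0_A),(0_D,1_A))$ with $D\Delta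 A=\{(d,a): d\in reg(\mathcal D)\text{ or }a=0_A\}$, $(d_1,a_1)\oplus(d_2,a_2)=(\min(d_1,d_2),a)$ where $a=a_1$ if $d_1<_Dd_2$, $a=a_2$ if $d_2<_Dd_1$, $a=a_1+_Aa_2$ if $d_1=d_2$; and $(d_1,a_1)\otimes(d_2,a_2)=(d_1+_Dd_2,a_1\times_Aa_2)$. *)

(* Defs.v *)
From HB Require Import structures.
From mathcomp Require Import all_boot all_algebra.
From mathcomp Require Import boolp.

Set Implicit Arguments.
Unset Strict Implicit.
Unset Printing Implicit Defensive.

Import GRing.Theory.
Local Open Scope ring_scope.

(* A dioid (D, min, +_D, infty_D, 0_D) is written with the semiring notations *)
(* of ssralg:  min is +,  +_D is *,  infty_D is 0,  and  0_D is 1.            *)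
(* Semirings are pzSemiRingTypes, so that 0 = 1 is not excluded.              *)

Definition dle (D : pzSemiRingType) (d1 d2 : D) : Prop := exists c, d2 + c = d1.

Definition dlt (D : pzSemiRingType) (d1 d2 : D) : Prop := dle d1 d2 /\ d1 <> d2.

HB.mixin Record PzSemiRing_isDioid D of GRing.PzSemiRing D := {
  dle_refl : forall d : D, dle d d;
  dle_anti : forall d1 d2 : D, dle d1 d2 -> dle d2 d1 -> d1 = d2;
  dle_trans : forall d1 d2 d3 : D, dle d1 d2 -> dle d2 d3 -> dle d1 d3;
}.

#[short(type="dioidType")]
HB.structure Definition Dioid :=
  {D of GRing.PzSemiRing D & PzSemiRing_isDioid D}.

HB.mixin Record Dioid_isIdempotent D of Dioid D := {
  dioid_addrr : forall d : D, d + d = d;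
}.

HB.mixin Record Dioid_isTotal D of Dioid D := {
  dle_total : forall d1 d2 : D, dle d1 d2 \/ dle d2 d1;
}.

#[short(type="comTotalIdemDioidType")]
HB.structure Definition ComTotalIdemDioid :=
  {D of GRing.ComPzSemiRing D & Dioid D & Dioid_isIdempotent D
      & Dioid_isTotal D}.

Definition dreg (D : comPzSemiRingType) (d : D) : Prop :=
  d <> 0 /\ forall b c : D, d * b = d * c -> b = c.

Section DeltaProduct.
Variables (D : comTotalIdemDioidType) (A : comPzSemiRingType).
Implicit Types (d : D) (a : A).

Record delta_prod := DeltaProd {
  delta_val : D * A;
  _ : `[< dreg delta_val.1 >] || (delta_val.2 == 0)
}.

HB.instance Definition _ := [isSub for delta_val].
HB.instance Definition _ := [Choice of delta_prod by <:].

Implicit Types p q r : delta_prod.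

Fact delta_proof d a :
  let x := (d, if `[< dreg d >] then a else 0) in
  `[< dreg x.1 >] || (x.2 == 0).
Proof. by rewrite /=; case: asboolP => //=. Qed.

Definition delta d a : delta_prod := DeltaProd (delta_proof d a).

(* As dle is total, the last case is d1 = d2. *)
Definition delta_add_val (x y : D * A) : D * A :=
  (x.1 + y.1,
   if `[< dlt x.1 y.1 >] then x.2
   else if `[< dlt y.1 x.1 >] then y.2
   else x.2 + y.2).

Definition delta_mul_val (x y : D * A) : D * A := (x.1 * y.1, x.2 * y.2).

Let sel d m a := if d == m then a else 0.

Let dleE d1 d2 : dle d1 d2 <-> d1 + d2 = d1.
Proof.
split=> [[c <-]|<-]; last by exists d1; rewrite addrC.
by rewrite addrAC dioid_addrr.
Qed.

Let delta_addE (x y : D * A) :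
  delta_add_val x y =
    (x.1 + y.1, sel x.1 (x.1 + y.1) x.2 + sel y.1 (x.1 + y.1) y.2).
Proof.
case: x y => [d1 a1] [d2 a2]; rewrite /delta_add_val /sel /=; congr pair.
case: asboolP => [[/dleE-> /eqP]|n12].
  by rewrite eqxx eq_sym => /negPf->; rewrite addr0.
case: asboolP => [[/dleE]|n21].
  by rewrite addrC => -> /eqP; rewrite eqxx eq_sym => /negPf->; rewrite add0r.
have ->: d1 = d2.
  by apply: contrapT => ne; case: (dle_total d1 d2) => h;
    [case: n12 | case: n21]; split=> // e; apply: ne.
by rewrite dioid_addrr eqxx.
Qed.

Let dregM d1 d2 : dreg d1 -> dreg d2 -> dreg (d1 * d2).
Proof.
move=> [nz1 r1] [nz2 r2]; split=> [e|b c].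
  by apply: nz2; apply: r1; rewrite e mulr0.
by rewrite -!mulrA => /r1/r2.
Qed.

Fact delta_add_proof p q :
  let x := delta_add_val (val p) (val q) in
  `[< dreg x.1 >] || (x.2 == 0).
Proof.
rewrite delta_addE /=; case: p q => [[d1 a1] /= h1] [[d2 a2] /= h2].
move: (d1 + d2) => m; rewrite -implyNb; apply/implyP => nr.
suff sel0 d a : `[< dreg d >] || (a == 0) -> sel d m a = 0.
  by rewrite !sel0 // addr0.
rewrite /sel; have [->|//] := eqVneq d m.
by rewrite (negPf nr) => /eqP.
Qed.

Fact delta_mul_proof p q :
  let x := delta_mul_val (val p) (val q) in
  `[< dreg x.1 >] || (x.2 == 0).
Proof.
case: p q => [[d1 a1] /= /orP[/asboolP r1|/eqP->]];
  last by move=> q; rewrite mul0r eqxx orbT.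
case=> [[d2 a2] /= /orP[/asboolP r2|/eqP->]]; last by rewrite mulr0 eqxx orbT.
by apply/orP; left; apply/asboolP/dregM.
Qed.

Definition delta_add p q : delta_prod := DeltaProd (delta_add_proof p q).
Definition delta_mul p q : delta_prod := DeltaProd (delta_mul_proof p q).

Fact delta_zero_proof :
  let x := (0, 0) : D * A in `[< dreg x.1 >] || (x.2 == 0).
Proof. by rewrite /= eqxx orbT. Qed.

Definition delta_zero : delta_prod := DeltaProd delta_zero_proof.

(* This is (0_D, 1_A) as soon as infty_D <> 0_D, see delta_oneE; if           *)
(* infty_D = 0_D then reg(D) is empty, the carrier is {(infty_D, 0_A)}, and   *)
(* the unit is that single element.                                           *)
Definition delta_one : delta_prod := delta 1 1.

Let dreg1 : (0 : D) <> 1 -> dreg (1 : D).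
Proof. by move=> nz; split=> [e|b c]; [apply: nz | rewrite !mul1r]. Qed.

Lemma delta_oneE : (0 : D) <> 1 -> delta_val delta_one = (1, 1).
Proof. by move/dreg1 => r; rewrite /=; case: asboolP. Qed.

Fact delta_addC : commutative delta_add.
Proof.
move=> p q; apply: val_inj; rewrite /= !delta_addE.
by rewrite [(val q).1 + _]addrC [X in (_, X)]addrC.
Qed.

Fact delta_addA : associative delta_add.
Proof.
have selD (d1 d2 m : D) (a b : A) : d1 + m = m -> d2 + m = m ->
  sel (d1 + d2) m (sel d1 (d1 + d2) a + sel d2 (d1 + d2) b)
  = sel d1 m a + sel d2 m b.
  move=> e1 e2; rewrite {1}/sel; case: eqP => [->//|ne].
  rewrite /sel; case: eqP => [e|_].
    by case: ne; rewrite e addrC e2.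
  by case: eqP => [e|_]; [case: ne; rewrite e e1 | rewrite addr0].
move=> p q r; apply: val_inj; rewrite /= !delta_addE /=.
case: (val p) (val q) (val r) => [d1 a1] [d2 a2] [d3 a3] /=.
have add1 (x y : D) : x + (x + y) = x + y by rewrite addrA dioid_addrr.
congr pair; first by rewrite addrA.
rewrite -[d1 + d2 + d3]addrA; set m := d1 + (d2 + d3).
have e1 : d1 + m = m by rewrite /m add1.
have e2 : d2 + m = m by rewrite /m addrCA add1.
have e3 : d3 + m = m by rewrite /m [d2 + _]addrC addrCA add1.
by rewrite !selD // addrA.
Qed.

Fact delta_add0 : left_id delta_zero delta_add.
Proof.
move=> p; apply: val_inj; rewrite /= delta_addE /= add0r.
case: p => [[d a] /= h]; congr pair; rewrite /sel eqxx.
by case: eqP => _; rewrite add0r.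
Qed.

Fact delta_mulA : associative delta_mul.
Proof. by move=> p q r; apply: val_inj; rewrite /= /delta_mul_val /= !mulrA. Qed.

Fact delta_mulC : commutative delta_mul.
Proof.
by move=> p q; apply: val_inj; rewrite /= /delta_mul_val mulrC [X in (_, X)]mulrC.
Qed.

Fact delta_mul1 : left_id delta_one delta_mul.
Proof.
move=> p; apply: val_inj; rewrite /= /delta_mul_val /= mul1r.
case: p => [[d a] /= h]; congr pair; case: asboolP => [_|nr].
  by rewrite mul1r.
have e01 : (0 : D) = 1 by apply: contrapT => /dreg1.
have ed (x : D) : x = 0 by rewrite -[x]mul1r -e01 mul0r.
case/orP: h => [/asboolP[]|/eqP->]; last by rewrite mulr0.
by rewrite [d]ed.
Qed.

Fact delta_mulDl : left_distributive delta_mul delta_add.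
Proof.
move=> p q r; apply: val_inj; rewrite /= !delta_addE /delta_mul_val /=.
case: (val p) (val q) r => [d1 a1] [d2 a2] [[d a] /= h].
rewrite -[d1 * d + _]mulrDl; congr pair.
case/orP: h => [/asboolP[_ r]|/eqP->].
  have selM (x m : D) b : sel x m b * a = sel (x * d) (m * d) (b * a).
    rewrite /sel; case: eqP => [->|ne]; first by rewrite eqxx.
    by case: eqP => [|_]; [rewrite ![_ * d]mulrC => /r | rewrite mul0r].
  by rewrite [LHS]mulrDl !selM.
by rewrite !mulr0 /sel !if_same addr0.
Qed.

Fact delta_mul0 : left_zero delta_zero delta_mul.
Proof. by move=> p; apply: val_inj; rewrite /= /delta_mul_val /= !mul0r. Qed.

HB.instance Definition _ :=
  GRing.isNmodule.Build delta_prod delta_addA delta_addC delta_add0.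
HB.instance Definition _ :=
  GRing.Nmodule_isComPzSemiRing.Build delta_prod
    delta_mulA delta_mulC delta_mul1 delta_mulDl delta_mul0.

End DeltaProduct.

Section Measure.
Variables S T : finType.

(* T^{S'} *)
Definition pfun (S' : {set S}) := {ffun {x : S | x \in S'} -> T}.

Lemma in_setU_notl (S1 S2 : {set S}) (x : {x : S | x \in S1 :|: S2}) :
  ~ val x \in S1 -> val x \in S2.
Proof. by case: x => x /=; rewrite inE => /orP[h []|]. Qed.

Definition pjoin (S1 S2 : {set S}) (f1 : pfun S1) (f2 : pfun S2) :
    pfun (S1 :|: S2) :=
  [ffun x : {x : S | x \in S1 :|: S2} =>
    match decP (@idP (val x \in S1)) with
    | left h => f1 (exist _ (val x) h)
    | right h => f2 (exist _ (val x) (in_setU_notl h))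
    end].

Lemma pjoinEl (S1 S2 : {set S}) (f1 : pfun S1) (f2 : pfun S2) (x : S)
    (h : x \in S1 :|: S2) (h1 : x \in S1) :
  pjoin f1 f2 (exist _ x h) = f1 (exist _ x h1).
Proof.
rewrite ffunE /=; case: (decP _) => [h'|/(_ h1)//].
by congr (f1 _); apply: val_inj.
Qed.

Lemma pjoinEr (S1 S2 : {set S}) (f1 : pfun S1) (f2 : pfun S2) (x : S)
    (h : x \in S1 :|: S2) (h2 : x \in S2) :
  [disjoint S1 & S2] -> pjoin f1 f2 (exist _ x h) = f2 (exist _ x h2).
Proof.
move=> dis; rewrite ffunE /=; case: (decP _) => h'.
  by have := disjointFr dis h'; rewrite h2.
by congr (f2 _); apply: val_inj.
Qed.

Definition family_fun (B : Type) := forall S' : {set S}, {set pfun S'} -> B.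

Record is_measure (B : comPzSemiRingType) (mu : family_fun B) : Prop := {
  measure_set0 : forall S' : {set S}, mu S' set0 = 0;
  measure_unit : mu set0 [set: pfun set0] = 1;
  measure_setU : forall (S' : {set S}) (F1 F2 : {set pfun S'}),
    [disjoint F1 & F2] -> mu S' (F1 :|: F2) = mu S' F1 + mu S' F2;
  measure_join : forall (S1 S2 : {set S}) (f1 : pfun S1) (f2 : pfun S2),
    [disjoint S1 & S2] ->
    mu (S1 :|: S2) [set pjoin f1 f2] = mu S1 [set f1] * mu S2 [set f2]
}.

Definition argmin (D : comPzSemiRingType) (w : family_fun D) (S' : {set S})
    (F : {set pfun S'}) : {set pfun S'} :=
  [set f in F | w S' [set f] == w S' F].

Definition delta_measure (D : comTotalIdemDioidType) (A : comPzSemiRingType)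
    (w : family_fun D) (mu : family_fun A) : family_fun (delta_prod D A) :=
  fun S' F => delta (w S' F) (mu S' (argmin w F)).

End Measure.

(* Main.v *)
Require Import Defs.
From HB Require Import structures.
From mathcomp Require Import all_boot all_algebra.
From mathcomp Require Import boolp.

Set Implicit Arguments.
Unset Strict Implicit.
Unset Printing Implicit Defensive.

Import GRing.Theory.
Local Open Scope ring_scope.

(** Since [w] is additive and idempotent, [w [set f]] lies above [w F] for every
    [f] in [F].  Hence, for disjoint [F1] and [F2], if [w F1 < w F2] then no
    element of [F2] attains [w (F1 :|: F2)], and if [w F1 = w F2] the minimizers
    of the union are the disjoint union of the minimizers; these are the cases of
    the addition of the delta product.  Multiplicativity on singletons holds
    because a product is regular exactly when both of its factors are. *)

Lemma dltE (D : comTotalIdemDioidType) (d1 d2 : D) :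
  dlt d1 d2 <-> d1 + d2 = d1 /\ d1 <> d2.
Proof.
split=> [[[c <-] ne]|[e ne]]; split=> //; first by rewrite addrAC dioid_addrr.
by exists d1; rewrite addrC.
Qed.

Lemma dltgt_total (D : comTotalIdemDioidType) (d1 d2 : D) :
  [\/ dlt d1 d2, dlt d2 d1 | d1 = d2].
Proof.
have [->|/eqP ne] := eqVneq d1 d2; first by constructor 3.
case: (dle_total d1 d2) => h; [constructor 1 | constructor 2]; split=> //.
exact: nesym.
Qed.

(** A factor inherits cancellation from the product: multiplying [d1 * b = d1 * c] by [d2] makes
    [d1 * d2] appear on both sides. *)
Lemma dreg_mul (D : comPzSemiRingType) (d1 d2 : D) :
  dreg (d1 * d2) <-> dreg d1 /\ dreg d2.
Proof.
split=> [[nz r]|[[nz1 r1] [nz2 r2]]]; last first.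
  split=> [e|b c]; last by rewrite -!mulrA => /r1/r2.
  by apply: nz2; apply: r1; rewrite e mulr0.
split; split=> [e|b c e].
- by apply: nz; rewrite e mul0r.
- by apply: r; rewrite [d1 * d2]mulrC -!mulrA e.
- by apply: nz; rewrite e mulr0.
- by apply: r; rewrite -!mulrA e.
Qed.

Section Delta.
Variables (D : comTotalIdemDioidType) (A : comPzSemiRingType).
Implicit Types (d : D) (a : A).

Lemma delta_r0 : delta 0 0 = 0 :> delta_prod D A.
Proof. by apply: val_inj; rewrite /= if_same. Qed.

(** By [dreg_mul], both second components are [a1 * a2] when [d1] and [d2] are regular, and 0
    otherwise. *)
Lemma deltaM d1 d2 a1 a2 :
  delta (d1 * d2) (a1 * a2) = delta d1 a1 * delta d2 a2.
Proof.
apply: val_inj; rewrite /= /delta_mul_val /=; congr pair.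
have -> : `[< dreg (d1 * d2) >] = `[< dreg d1 >] && `[< dreg d2 >].
  by rewrite -asbool_and; apply/asbool_equiv_eq/dreg_mul.
by do 2 case: `[< _ >]; rewrite /= ?mul0r ?mulr0.
Qed.

Lemma deltaD_lt d1 d2 a1 a2 :
  dlt d1 d2 -> delta d1 a1 + delta d2 a2 = delta d1 a1.
Proof.
move=> lt12; apply: val_inj; rewrite /= /delta_add_val /= (asboolT lt12).
by have [-> _] := (dltE d1 d2).1 lt12.
Qed.

Lemma deltaD_eq d a1 a2 : delta d a1 + delta d a2 = delta d (a1 + a2).
Proof.
have ndlt : ~ dlt d d by case.
apply: val_inj; rewrite /= /delta_add_val /= dioid_addrr (asboolF ndlt).
by case: `[< _ >]; rewrite ?addr0.
Qed.

End Delta.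

Section Argmin.
Variables (S T : finType).

Lemma argmin_sub (D : comPzSemiRingType) (w : family_fun S T D)
    (S' : {set S}) (F : {set pfun T S'}) : argmin w F \subset F.
Proof. by apply/subsetP => f; rewrite inE => /andP[]. Qed.

Lemma argmin_set1 (D : comPzSemiRingType) (w : family_fun S T D)
    (S' : {set S}) (f : pfun T S') : argmin w [set f] = [set f].
Proof.
apply/setP => g; rewrite !inE.
by have [->|//] := eqVneq g f; rewrite eqxx.
Qed.

Variables (D : comTotalIdemDioidType) (w : family_fun S T D).
Hypothesis hw : is_measure w.
Variable S' : {set S}.
Implicit Types (f : pfun T S') (F : {set pfun T S'}).

(** Splitting [f] off [F] exhibits [w [set f]] as a summand of [w F]; idempotence absorbs the second
    copy. *)
Lemma measure_set1_ge F f : f \in F -> w F + w [set f] = w F.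
Proof.
move=> fF; rewrite -(setD1K fF) (measure_setU hw) ?disjoints1 ?setD11 //.
by rewrite addrAC dioid_addrr.
Qed.

Lemma argminU_lt F1 F2 :
    [disjoint F1 & F2] -> dlt (w F1) (w F2) ->
  argmin w (F1 :|: F2) = argmin w F1.
Proof.
move=> dis /dltE[e12 ne12]; apply/setP => f; rewrite !inE (measure_setU hw) //.
rewrite e12; case: (boolP (f \in F1)) => //= _.
(* A minimizer [f] in [F2] would have value [w F1], so that [w F2 + w F1 = w F2]; with [e12] this
   forces [w F1 = w F2]. *)
apply/negP => /andP[/measure_set1_ge fF2 /eqP ef].
by apply: ne12; rewrite -e12 addrC -ef.
Qed.

Lemma argminU_eq F1 F2 :
    [disjoint F1 & F2] -> w F1 = w F2 ->
  argmin w (F1 :|: F2) = argmin w F1 :|: argmin w F2.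
Proof.
move=> dis e12; apply/setP => f.
by rewrite !inE (measure_setU hw) // e12 dioid_addrr andb_orl.
Qed.

Lemma delta_measureU (A : comPzSemiRingType) (mu : family_fun S T A) F1 F2 :
    is_measure mu -> [disjoint F1 & F2] ->
  delta_measure w mu (F1 :|: F2)
  = delta_measure w mu F1 + delta_measure w mu F2.
Proof.
move=> hmu dis; have dis' : [disjoint F2 & F1] by rewrite disjoint_sym.
rewrite /delta_measure; case: (dltgt_total (w F1) (w F2)) => [lt|lt|e].
- rewrite argminU_lt // deltaD_lt // (measure_setU hw) //.
  by have [-> _] := (dltE _ _).1 lt.
- rewrite addrC setUC argminU_lt // deltaD_lt // (measure_setU hw) //.
  by have [-> _] := (dltE _ _).1 lt.
rewrite argminU_eq // (measure_setU hw) // e dioid_addrr deltaD_eq.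
rewrite (measure_setU hmu) //.
(* Additivity of [mu] applies because the sets of minimizers inherit disjointness from [F1] and
   [F2]. *)
exact: disjointWl (argmin_sub _ _) (disjointWr (argmin_sub _ _) dis).
Qed.

End Argmin.

(** Functions on the empty domain agree vacuously. Seen as a singleton, the full set is its own
    [argmin]. *)
Lemma pfun_set0_setT (S T : finType) (f : pfun T (set0 : {set S})) :
  [set: pfun T set0] = [set f].
Proof.
apply/setP => g; rewrite !inE; apply/esym/eqP/ffunP => -[x hx].
by exfalso; rewrite inE in hx.
Qed.

Lemma pfun_set0_inh (S T : finType) : pfun T (set0 : {set S}).
Proof. by apply: finfun => -[x hx]; exfalso; rewrite inE in hx. Qed.

Theorem theorem6 (D : comTotalIdemDioidType) (A : comPzSemiRingType)
    (S T : finType) (w : family_fun S T D) (mu : family_fun S T A)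
    (hw : is_measure w) (hmu : is_measure mu) :
  is_measure (delta_measure w mu).
Proof.
split=> [S'||S' F1 F2|S1 S2 f1 f2 dis]; rewrite /delta_measure.
- have -> : argmin w (set0 : {set pfun T S'}) = set0.
    by apply/eqP; rewrite -subset0 argmin_sub.
  by rewrite (measure_set0 hw) (measure_set0 hmu) delta_r0.
- have eT := pfun_set0_setT (pfun_set0_inh S T).
  (* What remains is [delta 1 1 = 1], true by definition of the unit. *)
  by rewrite {2}eT argmin_set1 -eT (measure_unit hw) (measure_unit hmu).
- exact: delta_measureU.
- by rewrite !argmin_set1 (measure_join hw) // (measure_join hmu) // deltaM.
Qed.
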